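(* Let $P$ be a probability function on $\mathcal B$. If $P([\omega\upharpoonright n])>0$ for all $\omega\in\Omega$ and $n\in\mathbb N$, and $P$ converges to the truth almost uniformly, then $P$ has the approximation property and the CHT property.
   Context: $\mathbb N=\{1,2,3,\dots\}$; $\Omega=\{0,1\}^{\mathbb N}$ carries the product topology, and $\mathcal B$ is its Borel $\sigma$-algebra. For $\omega\in\Omega$, $n\in\mathbb N$, $[\omega\upharpoonright n]=\{\omega':\omega'_i=\omega_i,\ 1\le i\le n\}$. A probability function on $\mathcal B$ is a finitely additive (not necessarily countably additive) map $P:\mathcal B\to[0,1]$ with $P(\Omega)=1$. The time-$n$ posterior is $P_n(A)(\omega)=P(A\cap[\omega\upharpoonright n])/P([\omega\upharpoonright n])$. $P$ converges to the truth almost uniformly if for every $A\in\mathcal B$ and $\varepsilon>0$ there is $E\in\mathcal B$ with $P(E)<\varepsilon$ such that for every $r>0$ there is $N$ with $|P_n(A)(\omega)-\mathbf 1_A(\omega)|<r$ for all $n\ge N$, $\omega\notin E$. Approximation property: for every $A\in\mathcal B$ and $\varepsilon>0$ there is a clopen $C\subseteq\Omega$ with $P(A\triangle C)<\varepsilon$. CHT property: for $A\in\mathcal B$, $\delta\in(0,1)$, let $C_n(A,\delta)=\{\omega:P_n(A)(\omega)>\delta\}$ and $D_n(A,\delta)=C_n(A,\delta)\setminus\bigcup_{j<n}C_j(A,\delta)$; the property is that $P\big(\bigcup_{n\ge1}D_n(A,\delta)\big)=\sum_{n\ge1}P(D_n(A,\delta))$ for every $A\in\mathcal B$ and $\delta\in(0,1)$.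 *)

(* Defs.v *)
From mathcomp Require Import all_boot all_order all_algebra.
From mathcomp Require Import all_classical all_reals all_analysis.

Set Implicit Arguments.
Unset Strict Implicit.
Unset Printing Implicit Defensive.

Import Order.TTheory GRing.Theory Num.Theory.

Local Open Scope classical_set_scope.
Local Open Scope ring_scope.

(* Points of {0,1}^N, N = {1, 2, ...}, are stored with coordinates shifted by
   one: the i-th coordinate (i >= 1) of w is [w i.-1]. Times n are not shifted,
   so they are restricted to n > 0 throughout. *)
Definition Omega := g_sigma_algebraType (@open cantor_space).

(* [w |` n]: agreement on the first n coordinates. *)
Definition cylinder (w : Omega) (n : nat) : set Omega :=
  [set w' : Omega | forall i : nat, (i < n)%N -> w' i = w i].

Section ProbabilityFunctions.
Variable R : realType.
(* A [content] is nonnegative and finitely additive on the Borel sets; a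
   probability function is a content with [P setT = 1], whose values on Borel
   sets then lie in [0, 1], so that [fine] below loses nothing. Values on
   non-Borel sets are never used. *)
Variable P : {content set Omega -> \bar R}.

Definition posterior (n : nat) (A : set Omega) (w : Omega) : R :=
  fine (P (A `&` cylinder w n)) / fine (P (cylinder w n)).

Definition converges_to_truth_almost_uniformly : Prop :=
  forall (A : set Omega) (eps : R), measurable A -> 0 < eps ->
  exists E : set Omega, [/\ measurable E, (P E < eps%:E)%E &
    forall r : R, 0 < r ->
    exists2 N : nat, (0 < N)%N &
    forall (n : nat) (w : Omega), (N <= n)%N -> ~ E w ->
      `|posterior n A w - \1_A w| < r].

Definition approximation_property : Prop :=
  forall (A : set Omega) (eps : R), measurable A -> 0 < eps ->
  exists2 C : set Omega, @clopen cantor_space C & (P (A `+` C) < eps%:E)%E.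

Definition C_ (A : set Omega) (delta : R) (n : nat) : set Omega :=
  [set w | delta < posterior n A w].

Definition D_ (A : set Omega) (delta : R) (n : nat) : set Omega :=
  C_ A delta n `\` \bigcup_(j in [set j | (0 < j < n)%N]) C_ A delta j.

Definition CHT_property : Prop :=
  forall (A : set Omega) (delta : R), measurable A -> 0 < delta -> delta < 1 ->
  P (\bigcup_(n in [set n | (0 < n)%N]) D_ A delta n) =
  (\sum_(1 <= n <oo) P (D_ A delta n))%E.

End ProbabilityFunctions.

(* Main.v *)
Require Import Defs.
From mathcomp Require Import all_boot all_order all_algebra.
From mathcomp Require Import all_classical all_reals all_analysis.
From mathcomp Require Import lra.

Import Order.TTheory GRing.Theory Num.Theory.

Local Open Scope classical_set_scope.
Local Open Scope ring_scope.

(** Given [A] and [r > 0], almost uniform convergence yields one time [N] after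
which the posteriors of [A] are [r]-close to the truth off a small set [E].
With [r = 1/2], the clopen event that the posterior at time [N] exceeds [1/2]
differs from [A] only inside [E]. With [r = min(delta, 1 - delta)], a point
outside [E] whose posterior ever exceeds [delta] has it exceed [delta] by time
[N]: if the point lies in [A], already at time [N]; if it does not, the
posterior is below [delta] from time [N] on. So the union of all the [D_n] is
the union of the first [N], up to [E]. *)

Lemma cylinder_open (w : Omega) (n : nat) : @open cantor_space (cylinder w n).
Proof.
have -> : cylinder w n = \bigcap_(i in `I_n) [set w' : Omega | w' i = w i].
  by apply/seteqP; split => w' /= w'w i; exact: w'w.
rewrite bigcap_mkord; elim/big_ind: _ => //; first exact: openT.
  by move=> A B; exact: openI.
(* Fixing one coordinate is the preimage of a singleton, open in the discrete space [bool], under a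
   continuous projection. *)
move=> i _; apply: (@open_comp _ _ (fun w' : cantor_space => w' i) [set w i]).
  by move=> x _; exact: (@proj_continuous nat (fun=> bool) i x).
exact: discrete_open.
Qed.

Lemma eq_cylinder (w w' : Omega) (n : nat) :
  cylinder w n w' -> cylinder w' n = cylinder w n.
Proof.
by move=> ww'; apply/seteqP; split => v /= + i iln => /(_ i iln) ->;
  rewrite ww'.
Qed.

(** An invariant set is the union of the cylinders of its points, hence open; agreement on the first
    [n] coordinates is symmetric, so the complement is invariant and open too. *)
Lemma clopen_cylinder_invariant (S : set Omega) (n : nat) :
  (forall w w', cylinder w n w' -> S w -> S w') -> @clopen cantor_space S.
Proof.
have open_inv (V : set Omega) : (forall w w', cylinder w n w' -> V w -> V w') ->
    @open cantor_space V.
  move=> Vinv; have -> : V = \bigcup_(w in V) cylinder w n.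
    apply/seteqP; split => [w Vw|w' [w Vw /Vinv]]; last exact.
    by exists w.
  by apply: bigcup_open => w _; exact: cylinder_open.
move=> Sinv; split; first exact: open_inv.
rewrite -[S]setCK; apply: open_closedC; apply: open_inv => w w' ww' Sw Sw'.
by apply: Sw; apply: Sinv Sw' => i /ww'.
Qed.

Lemma open_Omega_measurable (S : set Omega) :
  @open cantor_space S -> measurable S.
Proof. exact: sub_sigma_algebra. Qed.

Section Posterior.
Variables (R : realType) (P : {content set Omega -> \bar R}).
Implicit Types (A : set Omega) (delta : R) (n : nat).

Lemma clopen_C_ A delta n : @clopen cantor_space (C_ P A delta n).
Proof.
apply: (@clopen_cylinder_invariant _ n) => w w' /eq_cylinder ww'.
by rewrite /C_ /posterior /= ww'.
Qed.

Lemma measurable_D_ A delta n : measurable (D_ P A delta n).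
Proof.
have mC k : measurable (C_ P A delta k).
  by apply: open_Omega_measurable; case: (clopen_C_ A delta k).
by apply: measurableD => //; exact: bigcup_measurable.
Qed.

(** The shift leaves out time 0: [D_] removes only the events at positive earlier times, so [D_] at
    time 0 could meet the later ones. *)
Lemma trivIset_D_ A delta : trivIset setT (fun n => D_ P A delta n.+1).
Proof.
have lt_disj i j w : (i < j)%N -> D_ P A delta i.+1 w ->
    D_ P A delta j.+1 w -> False.
  by move=> ij [Ci _] [_]; apply; exists i.+1.
move=> i j _ _ [w [Di Dj]]; case: (ltngtP i j) => // ij.
- by have := lt_disj _ _ _ ij Di Dj.
- by have := lt_disj _ _ _ ij Dj Di.
Qed.

(** The witness [j] is the least positive time at which the posterior at [w] exceeds [delta]. *)
Lemma C_sub_bigcup_D_ A delta n (w : Omega) : (0 < n)%N ->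
  C_ P A delta n w -> exists2 j, (0 < j <= n)%N & D_ P A delta j w.
Proof.
move=> n0 Cn.
have exC : exists m, (0 < m)%N && `[< C_ P A delta m w >].
  by exists n; rewrite n0; exact/asboolP.
case: (ex_minnP exC) => m /andP[m0 /asboolP Cm] minm; exists m.
  by rewrite m0 minm// n0; exact/asboolP.
split=> // -[j /= /andP[j0 jm] Cj].
by have := minm j; rewrite j0 leqNgt jm; move/asboolP: Cj => -> /(_ isT).
Qed.

Hypothesis P_conv : converges_to_truth_almost_uniformly P.

Lemma au_approximation : approximation_property P.
Proof.
move=> A eps mA eps0; have [E [mE PE /(_ 2^-1)]] := P_conv A eps mA eps0.
case=> [|N _ AN]; first by rewrite invr_gt0.
exists (C_ P A 2^-1 N); first exact: clopen_C_.
apply: le_lt_trans PE; have [/open_Omega_measurable mC _] := clopen_C_ A 2^-1 N.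
apply: le_measure; rewrite ?inE//.
  by apply: measurableU; exact: measurableD.
move=> w AC; apply: contrapT => nE; have := AN N w (leqnn N) nE.
rewrite /C_ in AC; rewrite ltr_norml; case: AC => -[/=].
(* The strict bound 1/2 on the error also excludes a posterior equal to 1/2 at a point of [A]. *)
- by move=> Aw /negP; rewrite -leNgt indicE mem_set//= => ?; lra.
- by move=> Cw nA; rewrite indicE memNset//=; lra.
Qed.

Lemma C_sub_first_D_ A delta eps : measurable A -> 0 < delta < 1 -> 0 < eps ->
  exists E N, [/\ measurable E, (P E < eps%:E)%E &
    forall n, (0 < n)%N -> C_ P A delta n `<=`
      \bigcup_(k in `I_N) D_ P A delta k.+1 `|` E].
Proof.
move=> mA /andP[d0 d1] eps0; have [E [mE PE]] := P_conv A eps mA eps0.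
case/(_ (Num.min delta (1 - delta))) => [|N N0 AN].
  by rewrite lt_min d0 subr_gt0.
exists E, N; split=> // n n0 w Cn.
have [Ew|nE] := pselect (E w); [by right|left].
have {n n0 Cn} [n /andP[n0 nN] Cn] :
    exists2 n, (0 < n <= N)%N & C_ P A delta n w.
  have [Aw|nA] := pselect (A w).
    exists N; first by rewrite N0 /=.
    have := AN N w (leqnn N) nE.
    by rewrite lt_min !ltr_norml indicE mem_set//= /C_ /=; lra.
  exists n => //; rewrite n0 leqNgt; apply/negP => /ltnW Nn.
  have := AN n w Nn nE; move: Cn.
  by rewrite lt_min !ltr_norml indicE memNset//= /C_ /=; lra.
have [[|j]// /andP[_ jn] Dj] := C_sub_bigcup_D_ _ _ _ _ n0 Cn.
by exists j => //=; exact: leq_trans jn nN.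
Qed.

Lemma au_CHT : CHT_property P.
Proof.
move=> A delta mA d0 d1; pose F n := D_ P A delta n.+1.
have mF n : measurable (F n) by exact: measurable_D_.
have F0 n : (0 <= P (F n))%E by exact: measure_ge0.
have -> : \bigcup_(n in [set n | (0 < n)%N]) D_ P A delta n = \bigcup_n F n.
  apply/seteqP; split => w; first by move=> [[|n]// _ Dn]; exists n.
  by move=> [n _ Dn]; exists n.+1.
have -> : (\sum_(1 <= n <oo) P (D_ P A delta n) = \sum_(n <oo) P (F n))%E.
  rewrite -(@nneseries_addn _ _ 1%N) => [|n]; last exact: measure_ge0.
  by apply: eq_eseriesr => n _; rewrite addn1.
have mU : measurable (\bigcup_n F n) by exact: bigcup_measurable.
(* That the series is at most the measure of the union holds for any content and disjoint sets; only
   the converse inequality needs convergence to the truth. *)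
apply/eqP; rewrite eq_le; apply/andP; split; last first.
  by apply: content_ring_sup_sigma_additive => //; exact: trivIset_D_.
apply/lee_addgt0Pr => eps eps0.
have d01 : 0 < delta < 1 by rewrite d0.
have [E [N [mE PE CE]]] := C_sub_first_D_ A delta eps mA d01 eps0.
have mV : measurable (\big[setU/set0]_(k < N) F k).
  exact: bigsetU_measurable.
(* Since [N] and [E] do not depend on the time, one finite union and one small set cover all the
   [F n] at once. *)
have UE : \bigcup_n F n `<=` \big[setU/set0]_(k < N) F k `|` E.
  by move=> w [n _ [Cn _]]; rewrite -bigcup_mkord; exact: CE Cn.
apply: (@le_trans _ _ (P (\big[setU/set0]_(k < N) F k `|` E))).
  by apply: le_measure => //; rewrite inE//; exact: measurableU.
apply: (le_trans (measureU2 P mV mE)); apply: leeD; last exact: ltW.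
(* Finite additivity turns the finite union into a partial sum, which is at most the series of
   nonnegative terms. *)
rewrite measure_bigsetU//; last exact: trivIset_D_.
by rewrite -(big_mkord xpredT (fun k => P (F k))); exact: nneseries_lim_ge.
Qed.

End Posterior.

Theorem proposition3p2 (R : realType) (P : {content set Omega -> \bar R})
    (P_total : P setT = 1%E)
    (P_pos : forall (w : Omega) (n : nat), (0 < n)%N ->
       (0 < P (cylinder w n))%E)
    (P_conv : converges_to_truth_almost_uniformly P) :
  approximation_property P /\ CHT_property P.
Proof. by split; [exact: au_approximation|exact: au_CHT]. Qed.
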